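(* Let $\nu\geq0$, $\lambda_1,\lambda_2,\lambda_3\in\mathbb{R}\setminus\{0\}$, and $\xi_k(x)=\exp(k(\lambda_1x_1+\lambda_2x_2+\lambda_3x_3))$ for $k=0,1,\dots,n$. Let $A_{jk}\in\mathbb{R}$ and $B_{jk}\in C[0,+\infty)$ ($j=1,2,3$, $k=0,\dots,n$). Suppose that the Cauchy problem $$\left\{\begin{array}{l}\partial_tu_j+\sum_{i=1}^3\big(u_i\,\partial_{x_i}u_j-\nu\,\partial_{x_i}^2u_j\big)+\partial_{x_j}p=f_j(x,t),\quad j=1,2,3,\\ \partial_{x_1}u_1+\partial_{x_2}u_2+\partial_{x_3}u_3=0,\qquad x\in\mathbb{R}^3,\ t\geq0,\\ u_j(x,0)=\sum_{k=0}^nA_{jk}\xi_k(x),\quad f_j(x,t)=\sum_{k=0}^nB_{jk}(t)\xi_k(x),\quad j=1,2,3,\end{array}\right.$$ has a solution of the form $u_j(x,t)=\sum_{k=0}^nT_{jk}(t)\xi_k(x)$ ($j=1,2,3$), $p(x,t)=\sum_{k=0}^nT_{4k}(t)\xi_k(x)$. Then a solution of this form is obtained with $$T_{j0}(t)=\int_0^tB_{j0}(s)\,ds+A_{j0}\ (j=1,2,3),\qquad T_{40}(t)=1,$$ and, for $k=1,\dots,n$, $$T_{4k}(t)=\frac{\sum_{j=1}^3\lambda_jB_{jk}(t)}{\sum_{j=1}^3\lambda_j^2k},$$ $$T_{jk}(t)=\exp(M_k(t))\Big(\int_0^t\big(B_{jk}(s)-\lambda_jk\,T_{4k}(s)\big)\exp(-M_k(s))\,ds+A_{jk}\Big),\quad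 j=1,2,3,$$ where $$M_k(t)=\sum_{i=1}^3\Big(\nu(\lambda_ik)^2t-\int_0^t\lambda_ik\,T_{i0}(s)\,ds\Big).$$
   Context: $n$ is a nonnegative integer. The case $\nu>0$ is the three-dimensional incompressible Navier-Stokes system with force $f=(f_1,f_2,f_3)$, velocity $u=(u_1,u_2,u_3)$ and pressure $p$; $\nu=0$ is the incompressible Euler system. *)

(* Defs.v *)
From Stdlib Require Import Reals.
From Coquelicot Require Import Coquelicot.
Open Scope R_scope.

Inductive coord : Set := c1 | c2 | c3.

Definition coord_eq_dec (i j : coord) : {i = j} + {i <> j}.
Proof. decide equality. Defined.

Definition sum3 (F : coord -> R) : R := F c1 + F c2 + F c3.

(* As a function space into R, this carries Coquelicot's sup-distance uniform
   structure, i.e. the usual topology of three-dimensional space. *)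
Definition R3 : Type := coord -> R.

Definition update (x : R3) (i : coord) (s : R) : R3 :=
  fun j => if coord_eq_dec i j then s else x j.

Definition ex_partial (i : coord) (g : R3 -> R) (x : R3) : Prop :=
  ex_derive (fun s => g (update x i s)) (x i).

Definition partial (i : coord) (g : R3 -> R) (x : R3) : R :=
  Derive (fun s => g (update x i s)) (x i).

(* Derivative relative to [0, +oo): two-sided for t > 0 and the right
   derivative at t = 0.  Values of h at negative times are irrelevant. *)
Definition is_time_derive (h : R -> R) (t l : R) : Prop :=
  filterdiff h (within (fun s => 0 <= s) (locally t)) (fun y => scal y l).

Definition continuous_nonneg (h : R -> R) : Prop :=
  continuous_on (fun t : R => 0 <= t) h.

Definition continuous_spacetime (g : R3 -> R -> R) : Prop :=
  continuous_on (fun z : (coord -> R) * R => 0 <= snd z)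
    (fun z : (coord -> R) * R => g (fst z) (snd z)).

(* Classical solutions on R^3 x [0, +oo): every derivative occurring in the
   system exists and is continuous, and the equations hold pointwise.  No time
   regularity is asked of p itself, which enters only through its gradient.
   The argument dtu is the time derivative of u. *)
Record solves_with (nu : R) (f : coord -> R3 -> R -> R) (a : coord -> R3 -> R)
    (u : coord -> R3 -> R -> R) (p : R3 -> R -> R)
    (dtu : coord -> R3 -> R -> R) : Prop := {
  sol_dt : forall j x t, 0 <= t -> is_time_derive (u j x) t (dtu j x t);
  sol_d1 : forall i j x t, 0 <= t -> ex_partial i (fun y => u j y t) x;
  sol_d2 : forall i j x t, 0 <= t ->
    ex_partial i (partial i (fun y => u j y t)) x;
  sol_dp : forall j x t, 0 <= t -> ex_partial j (fun y => p y t) x;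
  sol_cont : forall j, continuous_spacetime (u j);
  sol_cont_dt : forall j, continuous_spacetime (dtu j);
  sol_cont_d1 : forall i j,
    continuous_spacetime (fun x t => partial i (fun y => u j y t) x);
  sol_cont_d2 : forall i j,
    continuous_spacetime
      (fun x t => partial i (partial i (fun y => u j y t)) x);
  sol_cont_dp : forall j,
    continuous_spacetime (fun x t => partial j (fun y => p y t) x);
  sol_momentum : forall j x t, 0 <= t ->
    dtu j x t
    + sum3 (fun i => u i x t * partial i (fun y => u j y t) x
                     - nu * partial i (partial i (fun y => u j y t)) x)
    + partial j (fun y => p y t) x
    = f j x t;
  sol_div : forall x t, 0 <= t ->
    sum3 (fun i => partial i (fun y => u i y t) x) = 0;
  sol_init : forall j x, u j x 0 = a j x
}.

Definition is_solution (nu : R) (f : coord -> R3 -> R -> R)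
    (a : coord -> R3 -> R) (u : coord -> R3 -> R -> R) (p : R3 -> R -> R)
    : Prop :=
  exists dtu, solves_with nu f a u p dtu.

Definition xi (lam : coord -> R) (k : nat) (x : R3) : R :=
  exp (INR k * sum3 (fun i => lam i * x i)).

Definition expsum0 (lam : coord -> R) (n : nat) (A : nat -> R) (x : R3) : R :=
  sum_f_R0 (fun k => A k * xi lam k x) n.

Definition expsum (lam : coord -> R) (n : nat) (T : nat -> R -> R)
    (x : R3) (t : R) : R :=
  sum_f_R0 (fun k => T k t * xi lam k x) n.

(* The coefficients T_jk (j = 1, 2, 3) are velocity_coef, and T_4k is
   pressure_coef. *)
Definition velocity_coef0 (A : coord -> nat -> R) (B : coord -> nat -> R -> R)
    (j : coord) (t : R) : R :=
  RInt (B j 0%nat) 0 t + A j 0%nat.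

Definition pressure_coef (lam : coord -> R) (B : coord -> nat -> R -> R)
    (k : nat) (t : R) : R :=
  match k with
  | O => 1
  | S _ => sum3 (fun j => lam j * B j k t)
           / sum3 (fun j => lam j ^ 2 * INR k)
  end.

Definition exponent_M (nu : R) (lam : coord -> R) (A : coord -> nat -> R)
    (B : coord -> nat -> R -> R) (k : nat) (t : R) : R :=
  sum3 (fun i => nu * (lam i * INR k) ^ 2 * t
                 - RInt (fun s => lam i * INR k * velocity_coef0 A B i s) 0 t).

Definition velocity_coef (nu : R) (lam : coord -> R) (A : coord -> nat -> R)
    (B : coord -> nat -> R -> R) (j : coord) (k : nat) (t : R) : R :=
  match k with
  | O => velocity_coef0 A B j t
  | S _ =>
      exp (exponent_M nu lam A B k t)
      * (RInt (fun s => (B j k s - lam j * INR k * pressure_coef lam B k s)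
                        * exp (- exponent_M nu lam A B k s)) 0 t
         + A j k)
  end.

(* Main.v *)
(** Functions xi_k with different k are linearly independent, so the hypothesis
    that some solution has the exponential form forces, through the divergence
    at time 0, sum_j lambda_j A_jk = 0 for every k >= 1.  This is all that is
    needed from it.  The explicit T_jk solve T_jk' = M_k' T_jk + B_jk -
    lambda_j k T_4k with T_jk(0) = A_jk, and T_4k is such that
    sum_j lambda_j T_jk then stays 0 for k >= 1.  Hence u is divergence free,
    and in (u . grad) u only the x-independent part of u transports, which makes
    the momentum equation linear and equal to the above equations for T_jk. *)

Require Import Defs.
From Stdlib Require Import Reals Lra Lia.
From Coquelicot Require Import Coquelicot.
Open Scope R_scope.

(** * Linear independence of the exponentials *)

Lemma xi_0 (lam : coord -> R) (x : R3) : xi lam 0 x = 1.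
Proof. unfold xi; simpl INR; rewrite Rmult_0_l; exact exp_0. Qed.

(* Replacing F(s) by F(s+1) - e^n F(s) kills the last term and multiplies the
   k-th coefficient by e^k - e^n <> 0, so the claim follows by induction on n. *)
Lemma exp_independent (n : nat) (c : nat -> R) :
  (forall s, sum_f_R0 (fun k => c k * exp (INR k * s)) n = 0) ->
  forall k, (k <= n)%nat -> c k = 0.
Proof.
revert c; induction n as [|n IH]; intros c H k hk.
- replace k with 0%nat by lia.
  specialize (H 0); simpl in H; rewrite Rmult_0_l, exp_0 in H; lra.
- assert (low : forall k, (k <= n)%nat -> c k = 0).
  { intros l hl.
    assert (E : c l * (exp (INR l) - exp (INR (S n))) = 0).
    { apply (IH (fun k => c k * (exp (INR k) - exp (INR (S n))))); auto.
      intros s.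
      transitivity (sum_f_R0 (fun k => c k * exp (INR k * (s + 1))) (S n)
        - exp (INR (S n)) * sum_f_R0 (fun k => c k * exp (INR k * s)) (S n)).
      - rewrite scal_sum, <- minus_sum, tech5.
        rewrite Rmult_plus_distr_l, exp_plus, Rmult_1_r.
        rewrite (sum_eq _ (fun k => c k * exp (INR k * (s + 1))
          - c k * exp (INR k * s) * exp (INR (S n)))); [ring|].
        intros i _; rewrite Rmult_plus_distr_l, exp_plus, Rmult_1_r; ring.
      - rewrite !H; ring. }
    assert (exp (INR l) < exp (INR (S n))).
    { apply exp_increasing, lt_INR; lia. }
    apply Rmult_integral in E; destruct E; lra. }
  destruct (Nat.eq_dec k (S n)) as [->|ne]; [|apply low; lia].
  specialize (H 0); rewrite tech5, Rmult_0_r, exp_0 in H.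
  rewrite (sum_eq _ (fun _ => 0)) in H by (intros i hi; rewrite low by lia; ring).
  rewrite sum_cte in H; lra.
Qed.

(* c1 alone would denote a constant of the same name in Reals. *)
Lemma expsum0_independent (lam : coord -> R) (n : nat) (c : nat -> R) :
  lam Defs.c1 <> 0 -> (forall x, expsum0 lam n c x = 0) ->
  forall k, (k <= n)%nat -> c k = 0.
Proof.
intros h1 H; apply exp_independent; intros s.
(* At the point (s / lambda_1, 0, 0) the function xi_k takes the value exp(k s). *)
rewrite <- (H (update (fun _ => 0) Defs.c1 (s / lam Defs.c1))).
apply sum_eq; intros k _; unfold xi, update, sum3; simpl.
do 3 f_equal; field; exact h1.
Qed.

(** * Derivatives of exponential sums in space and time *)

Lemma expsum_ext (lam : coord -> R) (n : nat) (T T' : nat -> R -> R) x t :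
  (forall k, (k <= n)%nat -> T k t = T' k t) ->
  expsum lam n T x t = expsum lam n T' x t.
Proof. intros H; apply sum_eq; intros k hk; now rewrite H. Qed.

Lemma is_derive_expsum_space lam n T i x t :
  is_derive (fun s => expsum lam n T (update x i s) t) (x i)
    (expsum lam n (fun k s => lam i * INR k * T k s) x t).
Proof.
assert (term : forall k, is_derive (fun s => T k t * xi lam k (update x i s))
    (x i) (lam i * INR k * T k t * xi lam k x)).
{ intros k.
  (* The exponent is expanded around [x i], which makes it explicitly affine in [s] for every
     direction [i]. *)
  apply is_derive_ext with (fun s => T k t *
    exp (INR k * (sum3 (fun j => lam j * x j) + lam i * (s - x i)))).
  { intros s; unfold xi, sum3, update; destruct i; simpl; do 3 f_equal; ring. }
  auto_derive; [trivial|].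
  unfold xi; replace (x i + - x i) with 0 by ring.
  rewrite ?Rmult_0_r, ?Rplus_0_r; ring. }
unfold expsum; induction n as [|n IH]; simpl; [apply term|].
apply @is_derive_plus; auto.
Qed.

Lemma ex_partial_expsum lam n T i x t :
  ex_partial i (fun y => expsum lam n T y t) x.
Proof. eexists; apply is_derive_expsum_space. Qed.

Lemma partial_expsum lam n T i x t :
  partial i (fun y => expsum lam n T y t) x =
  expsum lam n (fun k s => lam i * INR k * T k s) x t.
Proof. apply is_derive_unique, is_derive_expsum_space. Qed.

Lemma partial2_expsum lam n T i x t :
  partial i (partial i (fun y => expsum lam n T y t)) x =
  expsum lam n (fun k s => lam i * INR k * (lam i * INR k * T k s)) x t.
Proof.
rewrite <- partial_expsum.
apply Derive_ext; intros s; apply partial_expsum.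
Qed.

Lemma is_derive_expsum_time lam n (T D : nat -> R -> R) x t :
  (forall k, is_derive (T k) t (D k t)) ->
  is_derive (expsum lam n T x) t (expsum lam n D x t).
Proof.
intros H; unfold expsum.
assert (term : forall k, is_derive (fun t => T k t * xi lam k x) t
    (D k t * xi lam k x)).
{ intros k; specialize (H k); auto_derive; [now exists (D k t)|].
  erewrite is_derive_unique by exact H; ring. }
induction n as [|n IH]; simpl; [apply term|].
apply @is_derive_plus; auto.
Qed.

(** * Derivatives relative to the half-line and transfer of solutions *)

(** [filterdiff] quantifies over all limits of its filter. Since t lies in [0, +oo), the restricted
    filter is proper, so t is its only limit, and there the two-sided estimate restricts. *)
Lemma is_time_derive_of_is_derive (h : R -> R) t l :
  0 <= t -> is_derive h t l -> is_time_derive h t l.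
Proof.
intros ht [lin H]; split; [exact lin|].
intros y hy eps.
assert (PF : ProperFilter' (within (fun s : R => 0 <= s) (locally t))).
{ constructor; [|apply within_filter; apply locally_filter].
  intros F; apply (locally_singleton t _ F ht). }
assert (E : y = t).
{ apply (is_filter_lim_unique (V := R_NormedModule) y t hy).
  intros P hP; unfold within; revert hP; apply filter_imp; auto. }
subst y; unfold within.
generalize (H t (fun P hP => hP) eps); apply filter_imp; auto.
Qed.

Lemma is_time_derive_ext (g h : R -> R) t l :
  0 <= t -> (forall s, 0 <= s -> g s = h s) ->
  is_time_derive g t l -> is_time_derive h t l.
Proof.
intros ht E [lin H]; split; [exact lin|].
intros y hy eps; generalize (H y hy eps); unfold within; apply filter_imp.
(* A negative limit [y] would put the negative reals in the filter, although t >= 0. Hence [g] and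
   [h] also agree at [y]. *)
assert (hy0 : 0 <= y).
{ apply Rnot_lt_le; intros neg.
  assert (F : within (fun s : R => 0 <= s) (locally t) (fun s => s < 0)).
  { apply hy; apply (open_lt 0 y neg). }
  generalize (locally_singleton t _ F ht); lra. }
intros s hs hs0; rewrite <- !E; auto.
Qed.

(** The same [dtu] serves both sides: space derivatives are taken at a fixed t >= 0, and time
    derivatives and continuity are relative to [0, +oo). *)
Lemma is_solution_ext nu f a u p f' u' p' :
  (forall j x t, 0 <= t -> f j x t = f' j x t) ->
  (forall j x t, 0 <= t -> u j x t = u' j x t) ->
  (forall x t, 0 <= t -> p x t = p' x t) ->
  is_solution nu f a u p -> is_solution nu f' a u' p'.
Proof.
intros Ef Eu Ep [dtu H]; exists dtu.
assert (Eu1 : forall i j x t, 0 <= t ->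
  partial i (fun y => u j y t) x = partial i (fun y => u' j y t) x).
{ intros; apply Derive_ext; auto. }
assert (Eu2 : forall i j x t, 0 <= t ->
  partial i (partial i (fun y => u j y t)) x =
  partial i (partial i (fun y => u' j y t)) x).
{ intros; apply Derive_ext; auto. }
assert (Ep1 : forall i x t, 0 <= t ->
  partial i (fun y => p y t) x = partial i (fun y => p' y t) x).
{ intros; apply Derive_ext; auto. }
destruct H as [Hdt Hd1 Hd2 Hdp Hc Hcdt Hcd1 Hcd2 Hcdp Hmom Hdiv Hinit]; constructor; try assumption.
- intros j x t ht; apply (is_time_derive_ext (u j x)); auto.
- intros i j x t ht; eapply ex_derive_ext; [|apply Hd1; exact ht]; simpl; auto.
- intros i j x t ht; eapply ex_derive_ext; [|apply Hd2; exact ht]; simpl; auto.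
- intros i x t ht; eapply ex_derive_ext; [|apply Hdp; exact ht]; simpl; auto.
- intros j; eapply continuous_on_ext; [|apply Hc]; simpl; auto.
- intros i j; eapply continuous_on_ext; [|apply (Hcd1 i j)]; simpl; auto.
- intros i j; eapply continuous_on_ext; [|apply (Hcd2 i j)]; simpl; auto.
- intros j; eapply continuous_on_ext; [|apply (Hcdp j)]; simpl; auto.
- intros j x t ht; rewrite <- Ef, <- (Hmom j x t ht) by exact ht.
  unfold sum3; rewrite !Eu1, !Eu2, Ep1, !Eu by exact ht; reflexivity.
- intros x t ht; rewrite <- (Hdiv x t ht).
  unfold sum3; rewrite !Eu1 by exact ht; reflexivity.
- intros j x; rewrite <- Hinit, Eu by lra; reflexivity.
Qed.

(** * Continuity, integrals and three-term sums *)

Lemma continuous_spacetime_expsum lam n (T : nat -> R -> R) :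
  (forall k t, continuous (T k) t) -> continuous_spacetime (expsum lam n T).
Proof.
intros HT; apply continuous_on_forall; intros z _; unfold expsum.
assert (coordc : forall i, continuous (fun z : (coord -> R) * R => fst z i) z).
{ intros i; apply (continuous_comp fst (fun x : coord -> R => x i)).
  - apply continuous_fst.
  (* A ball of the sup-distance projects into the ball of the same radius in each coordinate. *)
  - intros P [eps hP]; exists eps; intros y hy; apply hP, hy. }
assert (term : forall k,
  continuous (fun z : (coord -> R) * R => T k (snd z) * xi lam k (fst z)) z).
{ intros k; apply @continuous_mult.
  - apply (continuous_comp snd (T k)); [apply continuous_snd|apply HT].
  - unfold xi; apply (continuous_comp
      (fun z : (coord -> R) * R => INR k * sum3 (fun i => lam i * fst z i)) exp).
    + unfold sum3; apply @continuous_mult; [apply continuous_const|].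
      apply @continuous_plus; [apply @continuous_plus|];
        (apply @continuous_mult; [apply continuous_const|apply coordc]).
    + apply continuous_exp. }
induction n as [|n IH]; simpl; [apply term|].
apply @continuous_plus; auto.
Qed.

Lemma is_derive_RInt_continuous (f : R -> R) (a t : R) :
  (forall s, continuous f s) -> is_derive (fun t => RInt f a t) t (f t).
Proof.
intros hf; apply (is_derive_RInt f (fun t => RInt f a t) a t); [|apply hf].
exists posreal_one; intros s _.
apply (@RInt_correct R_CompleteNormedModule), (@ex_RInt_continuous R_CompleteNormedModule); auto.
Qed.

Lemma is_derive_continuous (f : R -> R) t l : is_derive f t l -> continuous f t.
Proof. intros H; apply @ex_derive_continuous; now exists l. Qed.

Lemma sum3_ext F G : (forall i, F i = G i) -> sum3 F = sum3 G.
Proof. intros H; unfold sum3; now rewrite !H. Qed.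

Lemma continuous_sum3 (F : coord -> R -> R) t :
  (forall i, continuous (F i) t) -> continuous (fun s => sum3 (fun i => F i s)) t.
Proof. intros H; unfold sum3; repeat apply @continuous_plus; auto. Qed.

Lemma is_derive_sum3 (F : coord -> R -> R) (D : coord -> R) t :
  (forall i, is_derive (F i) t (D i)) ->
  is_derive (fun s => sum3 (fun i => F i s)) t (sum3 D).
Proof. intros H; unfold sum3; repeat apply @is_derive_plus; auto. Qed.

Lemma sum3_RInt (c : coord -> R) (g : coord -> R -> R) (a t : R) :
  (forall i s, continuous (g i) s) ->
  sum3 (fun i => c i * RInt (g i) a t) =
  RInt (fun s => sum3 (fun i => c i * g i s)) a t.
Proof.
intros hg; symmetry; apply is_RInt_unique.
assert (H : forall i, is_RInt (fun s => c i * g i s) a t (c i * RInt (g i) a t)).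
{ intros i; apply @is_RInt_scal, (@RInt_correct R_CompleteNormedModule),
    (@ex_RInt_continuous R_CompleteNormedModule); auto. }
apply (is_RInt_plus (V := R_NormedModule) _ _ a t _ _
  (is_RInt_plus (V := R_NormedModule) _ _ a t _ _ (H Defs.c1) (H Defs.c2)) (H Defs.c3)).
Qed.

(** * Differential equations, initial values and divergence of the coefficients *)

(** The derivative M_k'(t). *)
Definition growth_rate nu lam A B (k : nat) (t : R) : R :=
  sum3 (fun i => nu * (lam i * INR k) ^ 2
                 - lam i * INR k * velocity_coef0 A B i t).

(** For k = 0 the factors [INR k] kill the growth and pressure terms and leave B_j0, so one formula
    covers all k. *)
Definition velocity_coef_dt nu lam A B j k t : R :=
  growth_rate nu lam A B k t * velocity_coef nu lam A B j k t
  + (B j k t - lam j * INR k * pressure_coef lam B k t).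

Lemma continuous_pressure_coef lam (B : coord -> nat -> R -> R) k t :
  (forall j k s, continuous (B j k) s) -> continuous (pressure_coef lam B k) t.
Proof.
intros hB; destruct k as [|k]; [apply continuous_const|].
apply @continuous_mult; [|apply continuous_const].
apply (continuous_sum3 (fun i s => lam i * B i (S k) s)); intros i.
apply @continuous_mult; [apply continuous_const|apply hB].
Qed.

Lemma is_derive_velocity_coef0 A (B : coord -> nat -> R -> R) j t :
  (forall j k s, continuous (B j k) s) ->
  is_derive (velocity_coef0 A B j) t (B j 0%nat t).
Proof.
intros hB; unfold velocity_coef0.
rewrite <- (Rplus_0_r (B j 0%nat t)).
apply @is_derive_plus; [|apply @is_derive_const].
apply is_derive_RInt_continuous, hB.
Qed.

Lemma is_derive_exponent_M nu lam A (B : coord -> nat -> R -> R) k t :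
  (forall j k s, continuous (B j k) s) ->
  is_derive (exponent_M nu lam A B k) t (growth_rate nu lam A B k t).
Proof.
intros hB; unfold exponent_M, growth_rate.
apply (is_derive_sum3 (fun i t => nu * (lam i * INR k) ^ 2 * t
  - RInt (fun s => lam i * INR k * velocity_coef0 A B i s) 0 t)); intros i.
apply @is_derive_minus;
  [auto_derive; [trivial|ring]|].
apply (is_derive_RInt_continuous (fun s => lam i * INR k * velocity_coef0 A B i s)).
intros s; apply @continuous_mult; [apply continuous_const|].
eapply is_derive_continuous, is_derive_velocity_coef0, hB.
Qed.

Lemma continuous_duhamel nu lam A (B : coord -> nat -> R -> R) j k s :
  (forall j k s, continuous (B j k) s) ->
  continuous (fun s => (B j k s - lam j * INR k * pressure_coef lam B k s)
                       * exp (- exponent_M nu lam A B k s)) s.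
Proof.
intros hB; apply @continuous_mult.
- apply @continuous_minus; [apply hB|].
  apply @continuous_mult; [apply continuous_const|].
  now apply continuous_pressure_coef.
- apply continuous_exp_comp, @continuous_opp.
  eapply is_derive_continuous, is_derive_exponent_M, hB.
Qed.

(** Variation of constants: differentiating exp(M) gives the term with m, and in exp(M) G' the two
    exponentials cancel to b. *)
Lemma is_derive_duhamel (M G : R -> R) (a m b t : R) :
  is_derive M t m -> is_derive G t (b * exp (- M t)) ->
  is_derive (fun s => exp (M s) * (G s + a)) t (m * (exp (M t) * (G t + a)) + b).
Proof.
intros dM dG.
auto_derive; [split; [now exists m|split; [eexists; exact dG|trivial]]|].
erewrite (is_derive_unique (fun x : R => M x)) by exact dM.
erewrite (is_derive_unique (fun x : R => G x)) by exact dG.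
rewrite exp_Ropp; field; apply Rgt_not_eq, exp_pos.
Qed.

Lemma is_derive_velocity_coef nu lam A (B : coord -> nat -> R -> R) j k t :
  (forall j k s, continuous (B j k) s) ->
  is_derive (velocity_coef nu lam A B j k) t (velocity_coef_dt nu lam A B j k t).
Proof.
intros hB; destruct k as [|k].
{ replace (velocity_coef_dt nu lam A B j 0 t) with (B j 0%nat t).
  - now apply is_derive_velocity_coef0.
  - unfold velocity_coef_dt, growth_rate, sum3; simpl; ring. }
apply (is_derive_duhamel (exponent_M nu lam A B (S k))
  (fun t => RInt (fun s => (B j (S k) s - lam j * INR (S k) * pressure_coef lam B (S k) s)
                           * exp (- exponent_M nu lam A B (S k) s)) 0 t)).
- now apply is_derive_exponent_M.
- apply (is_derive_RInt_continuous (fun s =>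
    (B j (S k) s - lam j * INR (S k) * pressure_coef lam B (S k) s)
    * exp (- exponent_M nu lam A B (S k) s))).
  intros s; now apply continuous_duhamel.
Qed.

Lemma velocity_coef_init nu lam A B j k : velocity_coef nu lam A B j k 0 = A j k.
Proof.
assert (Z : forall f : R -> R, RInt f 0 0 = 0).
{ intros f; apply (@RInt_point R_CompleteNormedModule). }
destruct k as [|k]; unfold velocity_coef, velocity_coef0, exponent_M, sum3;
  rewrite !Z; [ring|].
rewrite !Rmult_0_r, !Rminus_0_r, !Rplus_0_r, exp_0; ring.
Qed.

(* T_4k is chosen so that the integrands have zero divergence. *)
Lemma velocity_coef_div nu lam A (B : coord -> nat -> R -> R) k t :
  (forall i, lam i <> 0) -> (forall j k s, continuous (B j k) s) ->
  sum3 (fun j => lam j * A j (S k)) = 0 ->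
  sum3 (fun j => lam j * velocity_coef nu lam A B j (S k) t) = 0.
Proof.
intros hlam hB hA; unfold velocity_coef.
set (M := exponent_M nu lam A B (S k)).
set (g := fun j s => (B j (S k) s - lam j * INR (S k) * pressure_coef lam B (S k) s)
                     * exp (- M s)).
(* The factor exp(M_k) does not depend on j, so the divergence passes to the integrands and the
   initial data. *)
transitivity (exp (M t) * (sum3 (fun j => lam j * RInt (g j) 0 t)
                           + sum3 (fun j => lam j * A j (S k)))).
{ unfold sum3, g; ring. }
rewrite hA, sum3_RInt by (intros; now apply continuous_duhamel).
rewrite (RInt_ext _ (fun _ => 0)).
{ rewrite RInt_const; change (scal (t - 0) 0) with ((t - 0) * 0); ring. }
(* The denominator of T_4k is the positive sum of lambda_j^2 k, hence the sum of lambda_j (B_jk -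
   lambda_j k T_4k) is 0. *)
intros s _; unfold g, pressure_coef, sum3.
assert (0 < lam Defs.c1 ^ 2 /\ 0 < lam Defs.c2 ^ 2 /\ 0 < lam Defs.c3 ^ 2) as (p1 & p2 & p3).
{ rewrite <- !Rsqr_pow2; repeat split; apply Rsqr_pos_lt, hlam. }
assert (0 < INR (S k)) by (apply lt_0_INR; lia).
match goal with |- ?a = ?b => change (@eq R a b) end.
field; nra.
Qed.

(** * The constraint on the initial data *)

(** The divergence at time 0 is an exponential sum with coefficients k sum_j lambda_j A_jk.
    Independence makes them vanish, and k >= 1 can be divided out. *)
Lemma initial_divergence lam n nu f A T p :
  lam Defs.c1 <> 0 ->
  is_solution nu f (fun j => expsum0 lam n (A j)) (fun j => expsum lam n (T j)) p ->
  forall k, (S k <= n)%nat -> sum3 (fun j => lam j * A j (S k)) = 0.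
Proof.
intros h1 [dtu H] k hk.
assert (Z : INR (S k) * sum3 (fun j => lam j * A j (S k)) = 0).
{ apply (expsum0_independent lam n
    (fun k => INR k * sum3 (fun j => lam j * A j k)) h1); [|exact hk].
  intros x.
  rewrite <- (sol_div _ _ _ _ _ _ H x 0 (Rle_refl 0)).
  rewrite (sum3_ext (fun i => partial i (fun y => expsum lam n (T i) y 0) x)
    (fun i => expsum lam n (fun k _ => lam i * INR k * A i k) x 0)).
  - unfold sum3, expsum, expsum0; rewrite <- !plus_sum.
    apply sum_eq; intros; ring.
  (* The initial condition holds at every x, so it may be differentiated in space; this brings in
     A_jk without comparing it with T_jk(0). *)
  - intros i; rewrite <- (partial_expsum lam n (fun k _ => A i k)).
    apply Derive_ext; intros s; apply (sol_init _ _ _ _ _ _ H). }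
apply Rmult_integral in Z; destruct Z as [Z|Z]; [|exact Z].
exfalso; revert Z; apply not_0_INR; lia.
Qed.

(** * Verification of the system for forces continuous on the whole line *)

Lemma sum_f_R0_only_first (F : nat -> R) n :
  (forall k, (S k <= n)%nat -> F (S k) = 0) -> sum_f_R0 F n = F 0%nat.
Proof.
induction n as [|n IH]; intros H; [reflexivity|].
rewrite tech5, H, IH by lia || (intros; apply H; lia); ring.
Qed.

Lemma solution_of_continuous_force n nu lam A (B : coord -> nat -> R -> R) :
  (forall i, lam i <> 0) -> (forall j k s, continuous (B j k) s) ->
  (forall k, (S k <= n)%nat -> sum3 (fun j => lam j * A j (S k)) = 0) ->
  is_solution nu
    (fun j => expsum lam n (B j)) (fun j => expsum0 lam n (A j))
    (fun j => expsum lam n (velocity_coef nu lam A B j))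
    (expsum lam n (pressure_coef lam B)).
Proof.
intros hlam hB hA.
set (V := velocity_coef nu lam A B).
assert (cV : forall j k t, continuous (V j k) t).
{ intros; eapply is_derive_continuous, is_derive_velocity_coef, hB. }
assert (cP : forall k t, continuous (pressure_coef lam B k) t).
{ intros; now apply continuous_pressure_coef. }
assert (cmul : forall (c : R) (f : R -> R) t,
  continuous f t -> continuous (fun s => c * f s) t).
{ intros c f t hf; apply @continuous_mult; [apply continuous_const|exact hf]. }
exists (fun j => expsum lam n (velocity_coef_dt nu lam A B j)); constructor.
- intros j x t ht; apply is_time_derive_of_is_derive; [exact ht|].
  apply is_derive_expsum_time; intros k; now apply is_derive_velocity_coef.
- intros; apply ex_partial_expsum.
- intros i j x t _; eapply ex_derive_ext; [|
    apply (ex_partial_expsum lam n (fun k s => lam i * INR k * V j k s) i x t)].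
  intros s; symmetry; apply partial_expsum.
- intros; apply ex_partial_expsum.
- intros j; now apply continuous_spacetime_expsum.
- intros j; apply continuous_spacetime_expsum; intros k t.
  apply @continuous_plus.
  + apply @continuous_mult; [|apply cV].
    apply (continuous_sum3 (fun i t => nu * (lam i * INR k) ^ 2
                 - lam i * INR k * velocity_coef0 A B i t)); intros i.
    apply @continuous_minus; [apply continuous_const|].
    (* [velocity_coef0] is [velocity_coef] at k = 0 by conversion. *)
    apply cmul, (cV i 0%nat).
  + apply @continuous_minus; [apply hB|apply cmul, cP].
- intros i j; eapply continuous_on_ext.
  + intros z _; symmetry; apply partial_expsum.
  + apply (continuous_spacetime_expsum lam n (fun k s => lam i * INR k * V j k s)); auto.
- intros i j; eapply continuous_on_ext.
  + intros z _; symmetry; apply partial2_expsum.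
  + apply (continuous_spacetime_expsum lam n
      (fun k s => lam i * INR k * (lam i * INR k * V j k s))); auto.
- intros i; eapply continuous_on_ext.
  + intros z _; symmetry; apply partial_expsum.
  + apply (continuous_spacetime_expsum lam n
      (fun k s => lam i * INR k * pressure_coef lam B k s)); auto.
- intros j x t _.
  (* By incompressibility only the k = 0 part of u transports. *)
  assert (adv : sum3 (fun i => lam i * expsum lam n (V i) x t)
              = sum3 (fun i => lam i * velocity_coef0 A B i t)).
  { transitivity (sum_f_R0 (fun k => sum3 (fun i => lam i * V i k t) * xi lam k x) n).
    - unfold sum3, expsum; rewrite !scal_sum, <- !plus_sum.
      apply sum_eq; intros; ring.
    - rewrite sum_f_R0_only_first.
      + rewrite xi_0, Rmult_1_r; reflexivity.
      + intros k hk; unfold V; rewrite velocity_coef_div by auto; ring. }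
  (* Each x_i-derivative of u_j is lambda_i times a sum that does not depend on i. The advection
     therefore factors through the sum in [adv], and the viscosity through the sum of lambda_i^2. *)
  transitivity (expsum lam n (velocity_coef_dt nu lam A B j) x t
    + sum3 (fun i => lam i * expsum lam n (V i) x t)
      * expsum lam n (fun k s => INR k * V j k s) x t
    - nu * sum3 (fun i => lam i ^ 2)
      * expsum lam n (fun k s => INR k ^ 2 * V j k s) x t
    + expsum lam n (fun k s => lam j * INR k * pressure_coef lam B k s) x t).
  + assert (E1 : forall i, partial i (fun y => expsum lam n (V j) y t) x
        = lam i * expsum lam n (fun k s => INR k * V j k s) x t).
    { intros i; rewrite partial_expsum; unfold expsum; rewrite scal_sum.
      apply sum_eq; intros; ring. }
    assert (E2 : forall i, partial i (partial i (fun y => expsum lam n (V j) y t)) x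
        = lam i ^ 2 * expsum lam n (fun k s => INR k ^ 2 * V j k s) x t).
    { intros i; rewrite partial2_expsum; unfold expsum; rewrite scal_sum.
      apply sum_eq; intros; ring. }
    rewrite partial_expsum; unfold sum3; rewrite !E1, !E2; ring.
  (* Coefficients of xi_k are compared: M_k' T_jk cancels transport and viscosity, the pressure
     terms cancel, and B_jk remains. *)
  + rewrite adv; unfold expsum; rewrite !scal_sum, <- plus_sum, <- minus_sum, <- plus_sum.
    apply sum_eq; intros k _.
    unfold velocity_coef_dt, growth_rate, sum3; fold V; ring.
- intros x t _.
  transitivity (sum_f_R0
    (fun k => INR k * sum3 (fun i => lam i * V i k t) * xi lam k x) n).
  + unfold sum3; rewrite !partial_expsum; unfold expsum; rewrite <- !plus_sum.
    apply sum_eq; intros; ring.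
  (* The term k = 0 vanishes through its factor [INR 0]. *)
  + rewrite sum_f_R0_only_first; [simpl; ring|].
    intros k hk; unfold V; rewrite velocity_coef_div by auto; ring.
- intros j x; apply sum_eq; intros k _; unfold V; now rewrite velocity_coef_init.
Qed.

(** * Reduction to forces continuous on the whole line *)

(* B_jk is only controlled on [0, +oo); extending it lets all the derivatives in
   time be taken two-sided, also at t = 0. *)
Definition even_extension (h : R -> R) (t : R) : R := h (Rabs t).

(** [Rabs] is continuous with values in [0, +oo), so continuity relative to that half-line
    suffices. *)
Lemma continuous_even_extension (h : R -> R) t :
  continuous_nonneg h -> continuous (even_extension h) t.
Proof.
intros H P hP.
assert (N := H (Rabs t) (Rabs_pos t) P hP).
generalize (continuous_Rabs t _ N); unfold filtermap; apply filter_imp.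
intros s hs; apply hs, Rabs_pos.
Qed.

(** For t >= 0 the integral from 0 to t sees the force at nonnegative times only; the same reason
    serves [exponent_M_ext] and [velocity_coef_ext]. *)
Lemma velocity_coef0_ext A B B' j t : 0 <= t ->
  (forall s, 0 <= s -> B j 0%nat s = B' j 0%nat s) ->
  velocity_coef0 A B j t = velocity_coef0 A B' j t.
Proof.
intros ht E; unfold velocity_coef0; f_equal; apply RInt_ext.
intros s [hs _]; rewrite Rmin_left in hs by exact ht; apply E; lra.
Qed.

Lemma pressure_coef_ext lam B B' k t :
  (forall j, B j k t = B' j k t) ->
  pressure_coef lam B k t = pressure_coef lam B' k t.
Proof.
intros E; destruct k as [|k]; [reflexivity|].
unfold pressure_coef, sum3; now rewrite !E.
Qed.

Lemma exponent_M_ext nu lam A B B' k t : 0 <= t ->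
  (forall j s, 0 <= s -> B j 0%nat s = B' j 0%nat s) ->
  exponent_M nu lam A B k t = exponent_M nu lam A B' k t.
Proof.
intros ht E; apply sum3_ext; intros i; f_equal; apply RInt_ext.
intros s [hs _]; rewrite Rmin_left in hs by exact ht.
f_equal; apply velocity_coef0_ext; [lra|apply E].
Qed.

(** Mode 0 of the force enters through M_k, mode k through the integrand. *)
Lemma velocity_coef_ext nu lam A B B' j k t : 0 <= t ->
  (forall j s, 0 <= s -> B j 0%nat s = B' j 0%nat s) ->
  (forall j s, 0 <= s -> B j k s = B' j k s) ->
  velocity_coef nu lam A B j k t = velocity_coef nu lam A B' j k t.
Proof.
intros ht E0 E; destruct k as [|k]; [now apply velocity_coef0_ext; auto|].
unfold velocity_coef; rewrite (exponent_M_ext nu lam A B B') by auto.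
apply Rmult_eq_compat_l, Rplus_eq_compat_r, RInt_ext.
intros s [hs _]; rewrite Rmin_left in hs by exact ht.
rewrite E, (pressure_coef_ext lam B B'), (exponent_M_ext nu lam A B B');
  try reflexivity; try lra; auto; intros; apply E; lra.
Qed.

Theorem mainTheorem2 (n : nat) (nu : R) (lam : coord -> R)
    (A : coord -> nat -> R) (B : coord -> nat -> R -> R)
    (hnu : 0 <= nu) (hlam : forall i, lam i <> 0)
    (hB : forall j k, (k <= n)%nat -> continuous_nonneg (B j k))
    (hsol : exists (T : coord -> nat -> R -> R) (T4 : nat -> R -> R),
        is_solution nu
          (fun j => expsum lam n (B j)) (fun j => expsum0 lam n (A j))
          (fun j => expsum lam n (T j)) (expsum lam n T4)) :
  is_solution nu
    (fun j => expsum lam n (B j)) (fun j => expsum0 lam n (A j))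
    (fun j => expsum lam n (velocity_coef nu lam A B j)) (expsum lam n (pressure_coef lam B)).
Proof.
destruct hsol as (T & T4 & hT).
(* The modes k > n, whose continuity is not given, are replaced by 0, so that all of [B'] is
   continuous. *)
set (B' := fun j k => if Nat.leb k n then even_extension (B j k) else fun _ => 0).
assert (EB : forall j k s, (k <= n)%nat -> 0 <= s -> B' j k s = B j k s).
{ intros j k s hk hs; unfold B', even_extension.
  rewrite (proj2 (Nat.leb_le k n) hk), Rabs_pos_eq; auto. }
assert (cB : forall j k s, continuous (B' j k) s).
{ intros j k s; unfold B'; destruct (Nat.leb k n) eqn:hk.
  - apply continuous_even_extension, hB; now apply Nat.leb_le.
  - apply continuous_const. }
(* The constraint on A is drawn from the given solution with force [B], then used for [B']. *)
pose proof (solution_of_continuous_force n nu lam A B' hlam cB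
  (initial_divergence lam n nu _ A T _ (hlam Defs.c1) hT)) as H.
revert H; apply is_solution_ext.
- intros j x t ht; apply expsum_ext; auto.
- intros j x t ht; apply expsum_ext; intros k hk.
  apply velocity_coef_ext; auto; intros; apply EB; auto; lia.
- intros x t ht; apply expsum_ext; intros k hk; apply pressure_coef_ext; auto.
Qed.
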